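(* Let $(Z_i)_{i=1,\dots,N}$ be independent random variables with $\mathbb E[Z_i]=0$ and denote $Z_I:=\sum_{i\in I}Z_i$. If $\mathcal I$ is an arbitrary system of (nonempty) index sets $I\subset\{1,\dots,N\}$, then there exists a constant $C>0$ independent of $\mathcal I$ such that $$\mathbb E\left[\max_{I\in\mathcal I}\frac{|Z_I|}{\sqrt{|I|}}\right]\le C\sqrt{\log(\#(\mathcal I))}\ \mathbb E\left[\max_{1\le i\le N}|Z_i|\right].$$
   Context: $|I|$ and $\#(\mathcal I)$ denote cardinalities; $\log$ is the natural logarithm.
   Formalization: The system of index sets is assumed to have at least two members: for a single index set log(1)=0 and the inequality fails (N=1, a Rademacher variable, the system {{1}}), and for the empty system the maximum and log(0) are undefined. *)

(* Defs.v *)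
From mathcomp Require Export all_boot all_order all_algebra.
From mathcomp Require Export all_classical all_reals all_analysis.

Set Implicit Arguments.
Unset Strict Implicit.
Unset Printing Implicit Defensive.

Import Order.TTheory GRing.Theory Num.Theory.
Local Open Scope ring_scope.
Local Open Scope classical_set_scope.

Definition mutually_independent (R : realType) (d : measure_display)
    (T : measurableType d) (P : probability T R) (I : finType)
    (Z : I -> {RV P >-> R}) : Prop :=
  forall (J : {set I}) (B : I -> set R),
    (forall i, i \in J -> measurable (B i)) ->
    P (\bigcap_(i in [set` J]) (Z i @^-1` B i)) =
    (\prod_(i in J) P (Z i @^-1` B i))%E.

Definition partial_sum (R : realType) (T : Type) (N : nat)
    (Z : 'I_N -> T -> R) (I : {set 'I_N}) (w : T) : R :=
  \sum_(i in I) Z i w.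

(* Both maxima below range over nonnegative reals, so the default value 0 of
   the iterated maximum is harmless on nonempty index ranges. *)
Definition max_normalized_sum (R : realType) (T : Type) (N : nat)
    (Z : 'I_N -> T -> R) (S : {set {set 'I_N}}) (w : T) : R :=
  \big[Num.max/0]_(I in S) (`|partial_sum Z I w| / Num.sqrt (#|I|%:R)).

Definition max_abs (R : realType) (T : Type) (N : nat)
    (Z : 'I_N -> T -> R) (w : T) : R :=
  \big[Num.max/0]_(i < N) `|Z i w|.

(* Main.v *)
(** Write Phi for the normalized maximum, a seminorm in the vector
    (Z_1, ..., Z_N).  For each fixed vector of signs s, split Z = Z_A + Z_B
    according to the sign.  Since Z_B is centered and independent of Z_A, the
    conditional Jensen inequality gives E Phi(Z_A) <= E Phi(Z_A - Z_B)
    = E Phi(sZ), and symmetrically for Z_B, so that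
    E Phi(Z) <= 2 E Phi(sZ); no independent copy of Z is required.
    Averaging over s, it remains to bound pointwise the average of Phi(sZ) by
    4 sqrt(log #S) max |Z_i|, which is the exponential-moment bound for finite
    maxima of Rademacher sums. *)
From mathcomp Require Import ring lra zify measurable_realfun.
Require Import Defs.
Set Implicit Arguments.
Unset Strict Implicit.
Unset Printing Implicit Defensive.
Import Order.TTheory GRing.Theory Num.Theory.
Local Open Scope ring_scope.
Local Open Scope classical_set_scope.

(** * Exponential moments of Rademacher sums *)

(* The sharp exponent is [x ^+ 2 / 2]; the factor 2 makes the proof elementary:
   compare with [(1 - x ^+ 2)^-1] for small [x] and with [expR x] otherwise. *)
Lemma cosh_le_expR (R : realType) (x : R) :
  (expR x + expR (- x)) / 2 <= expR (2 * x ^+ 2).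
Proof.
wlog x0 : x / 0 <= x.
  move=> h; have [/h //|/ltW x0] := leP 0 x.
  by have := h (- x); rewrite opprK sqrrN addrC; apply; rewrite oppr_ge0.
have [x2|x2] := leP x (1 / 2).
  have x21 : x ^+ 2 <= x / 2 by nra.
  have e1 : expR x <= (1 - x)^-1.
    rewrite -[x in expR x]opprK expRN lef_pV2 ?posrE ?expR_gt0 //; last by lra.
    by have := expR_ge1Dx (- x).
  have e2 : expR (- x) <= (1 + x)^-1.
    rewrite expRN lef_pV2 ?posrE ?expR_gt0 //; last by lra.
    exact: expR_ge1Dx.
  apply: le_trans (expR_ge1Dx _).
  apply: (@le_trans _ _ (((1 - x)^-1 + (1 + x)^-1) / 2)); first by lra.
  have -> : ((1 - x)^-1 + (1 + x)^-1) / 2 = (1 - x ^+ 2)^-1.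
    by field; rewrite !lt0r_neq0 //; lra.
  rewrite -div1r ler_pdivrMr; last by lra.
  have : 0 <= x ^+ 2 by rewrite sqr_ge0.
  by nra.
apply: (@le_trans _ _ (expR x)).
  have : expR (- x) <= expR x by rewrite ler_expR; lra.
  by lra.
by rewrite ler_expR; nra.
Qed.

(** The expectation over independent uniform signs, encoded as a finite average over the [2 ^+ N]
    sign vectors. *)
Definition sign_average {R : realType} {N : nat} (f : ('I_N -> R) -> R) : R :=
  (\sum_(e : {ffun 'I_N -> bool}) f (fun i => (-1) ^+ e i)) / 2 ^+ N.

Lemma le_sign_average (R : realType) (N : nat) (f g : ('I_N -> R) -> R) :
  (forall s, f s <= g s) -> sign_average f <= sign_average g.
Proof.
move=> fg; rewrite /sign_average ler_pM2r ?invr_gt0 ?exprn_gt0 //.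
by apply: ler_sum => e _; exact: fg.
Qed.

(** The exponential of the sum is a product over coordinates, and distributing turns the average
    into a product of values of cosh, each bounded by [cosh_le_expR]. *)
Lemma sign_average_expR_sum (R : realType) (N : nat) (a : 'I_N -> R) :
  sign_average (fun s => expR (\sum_i s i * a i))
  <= expR (2 * \sum_i a i ^+ 2).
Proof.
rewrite /sign_average.
have -> : \sum_(e : {ffun 'I_N -> bool}) expR (\sum_i (-1) ^+ e i * a i) =
    \prod_(i < N) (expR (a i) + expR (- a i)).
  transitivity (\prod_(i < N) \sum_(b : bool) expR ((-1) ^+ b * a i)).
    rewrite bigA_distr_bigA; apply: eq_bigr => e _.
    exact: expR_sum.
  by apply: eq_bigr => i _; rewrite big_bool /= expr1 expr0 mulN1r mul1r addrC.
have -> : (2 : R) ^+ N = \prod_(i < N) 2 by rewrite prodr_const card_ord.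
rewrite -prodf_div mulr_sumr expR_sum; apply: ler_prod => i _.
by rewrite cosh_le_expR andbT divr_ge0 // addr_ge0 ?expR_ge0.
Qed.

Lemma sign_average_cst (R : realType) (N : nat) (c : R) :
  @sign_average R N (fun=> c) = c.
Proof.
rewrite /sign_average sumr_const card_ffun card_bool card_ord -[c *+ _]mulr_natr natrX.
by rewrite mulfK // expf_neq0.
Qed.

Lemma sign_averageD (R : realType) (N : nat) (f g : ('I_N -> R) -> R) :
  sign_average (fun s => f s + g s) = sign_average f + sign_average g.
Proof. by rewrite /sign_average big_split mulrDl. Qed.

Lemma sign_averageZ (R : realType) (N : nat) (c : R) (f : ('I_N -> R) -> R) :
  sign_average (fun s => c * f s) = c * sign_average f.
Proof. by rewrite /sign_average -mulr_sumr mulrA. Qed.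

Lemma sign_average_sum (R : realType) (N : nat) (J : finType) (S : {set J})
    (f : J -> ('I_N -> R) -> R) :
  sign_average (fun s => \sum_(j in S) f j s) = \sum_(j in S) sign_average (f j).
Proof. by rewrite /sign_average exchange_big mulr_suml. Qed.

(** * Pointwise bound for the sign average of the normalized maximum *)

(** Exhibits the normalized maximum as a maximum of linear forms, the shape used both by the
    exponential bound and by the conditional comparison. *)
Lemma normalized_absE (R : realType) (T : Type) (N : nat) (Z : 'I_N -> T -> R)
    (I : {set 'I_N}) (a : 'I_N -> R) (w : T) :
  `|partial_sum (fun i w => a i * Z i w) I w| / Num.sqrt (#|I|%:R) =
  Num.max (\sum_i (i \in I)%:R / Num.sqrt (#|I|%:R) * a i * Z i w)
          (\sum_i - ((i \in I)%:R / Num.sqrt (#|I|%:R) * a i) * Z i w).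
Proof.
have E : \sum_i (i \in I)%:R / Num.sqrt (#|I|%:R) * a i * Z i w =
    partial_sum (fun i w => a i * Z i w) I w / Num.sqrt (#|I|%:R).
  rewrite /partial_sum [in RHS]big_mkcond mulr_suml; apply: eq_bigr => i _.
  by case: (i \in I); rewrite ?mul0r // -mulrA mulrC mul1r.
have -> : \sum_i - ((i \in I)%:R / Num.sqrt (#|I|%:R) * a i) * Z i w =
    - (partial_sum (fun i w => a i * Z i w) I w / Num.sqrt (#|I|%:R)).
  by rewrite -E -sumrN; apply: eq_bigr => i _; rewrite mulNr.
rewrite E; set x := partial_sum _ _ _; set r := Num.sqrt _.
have r0 : 0 <= r^-1 by rewrite invr_ge0 sqrtr_ge0.
have -> : `|x| / r = `|x / r| by rewrite normrM (ger0_norm r0).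
by case: (ger0P (x / r)) => h; apply/esym; [apply/max_idPl | apply/max_idPr]; lra.
Qed.

Lemma max_abs_ge (R : realType) (T : Type) (N : nat) (Z : 'I_N -> T -> R)
    (i : 'I_N) (w : T) : `|Z i w| <= max_abs Z w.
Proof. by rewrite /max_abs; exact: (le_bigmax 0 (fun i => `|Z i w|)). Qed.

Lemma max_abs_ge0 (R : realType) (T : Type) (N : nat) (Z : 'I_N -> T -> R)
    (w : T) : 0 <= max_abs Z w.
Proof. by rewrite /max_abs; exact: bigmax_ge_id. Qed.

(** The left side is the average of the squares of [Z i w] over [I]; the division by the square root
    of the size of [I] thus makes the variance proxy uniform in [I]. *)
Lemma sum_sqr_normalized_le (R : realType) (T : Type) (N : nat)
    (Z : 'I_N -> T -> R) (I : {set 'I_N}) (w : T) : I != finset.set0 ->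
  \sum_i ((i \in I)%:R / Num.sqrt (#|I|%:R) * Z i w) ^+ 2 <= max_abs Z w ^+ 2.
Proof.
rewrite -card_gt0 => I0.
have I0R : 0 < #|I|%:R :> R by rewrite ltr0n.
have -> : \sum_i ((i \in I)%:R / Num.sqrt (#|I|%:R) * Z i w) ^+ 2 =
    (\sum_(i in I) Z i w ^+ 2) / #|I|%:R.
  rewrite [in RHS]big_mkcond mulr_suml; apply: eq_bigr => i _.
  rewrite !exprMn exprVn sqr_sqrtr ?ler0n //.
  by case: (i \in I); rewrite /= ?expr0n ?expr1n ?mul0r // mul1r mulrC.
rewrite ler_pdivrMr // mulr_natr -sumr_const; apply: ler_sum => i _.
by rewrite -[Z i w ^+ 2]real_normK ?num_real // lerXn2r ?nnegrE ?max_abs_ge ?max_abs_ge0.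
Qed.

(** The union bound at the level of exponentials: each absolute value contributes the two
    exponentials of its linear form and of the opposite form. *)
Lemma max_normalized_sum_exp_le (R : realType) (T : Type) (N : nat)
    (Z : 'I_N -> T -> R) (S : {set {set 'I_N}}) (a : 'I_N -> R) (t : R) (w : T) :
  0 < t -> S != finset.set0 ->
  expR (t * max_normalized_sum (fun i w => a i * Z i w) S w) <=
  \sum_(I in S)
    (expR (\sum_i a i * (t * ((i \in I)%:R / Num.sqrt (#|I|%:R) * Z i w))) +
     expR (\sum_i a i * (- t * ((i \in I)%:R / Num.sqrt (#|I|%:R) * Z i w)))).
Proof.
move=> t0 /set0Pn [J JS]; set G := \sum_(I in S) _.
have exp_max (x y : R) : expR (Num.max x y) <= expR x + expR y.
  by case: (leP x y) => _; rewrite ?lerDl ?lerDr expR_ge0.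
have term_le I : I \in S ->
    expR (t * (`|partial_sum (fun i w => a i * Z i w) I w| / Num.sqrt (#|I|%:R)))
    <= G.
  move=> IS; rewrite /G (bigD1 I) //=.
  apply: ler_wpDr.
    by apply: sumr_ge0 => *; rewrite addr_ge0 ?expR_ge0.
  rewrite normalized_absE maxr_pMr ?(ltW t0) // !mulr_sumr.
  have e1 : \sum_i t * ((i \in I)%:R / Num.sqrt (#|I|%:R) * a i * Z i w) =
      \sum_i a i * (t * ((i \in I)%:R / Num.sqrt (#|I|%:R) * Z i w)).
    by apply: eq_bigr => i _; ring.
  have e2 : \sum_i t * (- ((i \in I)%:R / Num.sqrt (#|I|%:R) * a i) * Z i w) =
      \sum_i a i * (- t * ((i \in I)%:R / Num.sqrt (#|I|%:R) * Z i w)).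
    by apply: eq_bigr => i _; ring.
  by rewrite e1 e2; exact: exp_max.
have G0 : 0 < G by exact: lt_le_trans (expR_gt0 _) (term_le J JS).
have le_lnG I : I \in S ->
    `|partial_sum (fun i w => a i * Z i w) I w| / Num.sqrt (#|I|%:R) <= ln G / t.
  by move=> IS; rewrite ler_pdivlMr // mulrC -ler_expR lnK ?posrE //; exact: term_le.
rewrite -[leRHS]lnK ?posrE // ler_expR mulrC -ler_pdivlMr //.
(* The default value 0 of the maximum must also lie below [ln G / t]; the nonnegative term of [J]
   gives this. *)
apply: bigmax_le => //; apply: le_trans (le_lnG J JS).
by rewrite divr_ge0 // sqrtr_ge0.
Qed.

(* [expR] lies above its tangent at [c]. *)
Lemma sign_average_le_ln (R : realType) (N : nat) (f : ('I_N -> R) -> R) (c : R) :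
  sign_average (fun s => expR (f s)) <= expR c -> sign_average f <= c.
Proof.
move=> fc.
have tangent s : f s <= (c - 1) + expR (- c) * expR (f s).
  by have := expR_ge1Dx (f s - c); rewrite expRD mulrC; lra.
apply: (le_trans (le_sign_average tangent)).
rewrite sign_averageD sign_average_cst sign_averageZ.
have : expR (- c) * sign_average (fun s => expR (f s)) <= 1.
  by rewrite expRN mulrC ler_pdivrMr ?expR_gt0 // mul1r.
by lra.
Qed.

Lemma sign_average_max_normalized_sum (R : realType) (T : Type) (N : nat)
    (Z : 'I_N -> T -> R) (S : {set {set 'I_N}}) (w : T) :
  (forall I, I \in S -> I != finset.set0) -> (2 <= #|S|)%N ->
  sign_average (fun s => max_normalized_sum (fun i w => s i * Z i w) S w)
  <= 4 * Num.sqrt (ln #|S|%:R) * max_abs Z w.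
Proof.
move=> S0 S2.
have S2R : 2 <= #|S|%:R :> R by rewrite ler_nat.
have lnS0 : 0 < ln #|S|%:R :> R by rewrite ln_gt0 //; lra.
(* The degenerate case is split off because the parameter [t] chosen below divides by the
   maximum. *)
have [M0|M0] := eqVneq (max_abs Z w) 0.
  have Z0 i : Z i w = 0.
    by apply/eqP; rewrite -normr_le0 -M0 max_abs_ge.
  rewrite M0 mulr0 -[leRHS](@sign_average_cst R N).
  apply: le_sign_average => s; apply: bigmax_le => // I _.
  by rewrite /partial_sum big1 ?normr0 ?mul0r // => i _; rewrite Z0 mulr0.
have {}M0 : 0 < max_abs Z w by rewrite lt0r M0 max_abs_ge0.
set M := max_abs Z w in M0 *; set L := Num.sqrt _.
have L0 : 0 < L by rewrite sqrtr_gt0.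
have L2 : L ^+ 2 = ln #|S|%:R by rewrite sqr_sqrtr // ltW.
(* With this [t], the scaled coefficients have sum of squares at most [t ^+ 2 * M ^+ 2 = L ^+ 2],
   which is the logarithm of the number of sets. *)
pose t := L / M.
have t0 : 0 < t by rewrite divr_gt0.
have tM : t * M = L by rewrite divfK // lt0r_neq0.
suff : sign_average
    (fun s => t * max_normalized_sum (fun i w => s i * Z i w) S w) <= 4 * L ^+ 2.
  rewrite sign_averageZ mulrC -ler_pdivlMr // => /le_trans; apply.
  by rewrite ler_pdivrMr // -!mulrA [M * t]mulrC tM expr2.
apply: sign_average_le_ln.
have Sn0 : S != finset.set0 by rewrite -card_gt0; lia.
apply: (le_trans (le_sign_average (fun s => max_normalized_sum_exp_le Z s w t0 Sn0))).
rewrite sign_average_sum.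
have term_le u I : `|u| = t -> I \in S -> sign_average (fun s => expR
    (\sum_i s i * (u * ((i \in I)%:R / Num.sqrt (#|I|%:R) * Z i w))))
    <= expR (2 * L ^+ 2).
  move=> ut IS; apply: (le_trans (sign_average_expR_sum _)).
  rewrite ler_expR ler_pM2l //.
  under eq_bigr do rewrite exprMn.
  rewrite -mulr_sumr -tM exprMn -ut real_normK ?num_real // ler_wpM2l ?sqr_ge0 //.
  exact: sum_sqr_normalized_le (S0 _ IS).
apply: (@le_trans _ _ (\sum_(I in S) (2 * expR (2 * L ^+ 2)))).
  apply: ler_sum => I IS; rewrite sign_averageD.
  have := term_le t I (gtr0_norm t0) IS.
  have := term_le (- t) I _ IS; rewrite normrN => /(_ (gtr0_norm t0)).
  by lra.
have eS : #|S|%:R = expR (L ^+ 2) by rewrite L2 lnK // posrE; lra.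
rewrite sumr_const -[_ *+ #|_|]mulr_natr eS.
(* One [L ^+ 2] counts the sets, [2 * L ^+ 2] is the exponential moment, and the last [L ^+ 2]
   absorbs the factor 2 of the two signs, since [2 <= #|S|]. *)
have -> : 4 * L ^+ 2 = L ^+ 2 + 2 * L ^+ 2 + L ^+ 2 by ring.
rewrite !expRD -eS mulrAC [leRHS]mulrAC ler_pM2r ?expR_gt0 //.
by rewrite ler_pM2r //; lra.
Qed.

(** * Independence of one variable from the sigma-algebra of others *)

(** A pi-system generating the sigma-algebra of the variables [Z i] with [i] in [A], on which
    independence gives product formulas directly. *)
Definition cylinders {R : realType} {d : measure_display}
    {T : measurableType d} {P : probability T R} {I : finType}
    (Z : I -> {RV P >-> R}) (A : {set I}) : set (set T) :=
  [set E | exists B : I -> set R, (forall i, measurable (B i)) /\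
    E = \bigcap_(i in [set` A]) (Z i @^-1` B i)].

Section conditional.
Context {R : realType} {d : measure_display} {T : measurableType d}.
Context (P : probability T R) {I : finType} (Z : I -> {RV P >-> R}).
Implicit Types (A : {set I}) (E : set T).

Lemma cylinders_setT A : cylinders Z A setT.
Proof.
exists (fun=> setT); split=> //.
by rewrite predeqE => w; split.
Qed.

Lemma cylinders_measurable A : cylinders Z A `<=` measurable.
Proof.
move=> _ [B [mB ->]]; apply: fin_bigcap_measurable => //.
move=> i _; rewrite -[X in measurable X]setTI.
exact: measurable_funP.
Qed.

Lemma g_cylinders_measurable A : <<s cylinders Z A >> `<=` measurable.
Proof.
apply: smallest_sub; last exact: cylinders_measurable.
exact: sigma_algebra_measurable.
Qed.

Lemma cylinders_setI A : setI_closed (cylinders Z A).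
Proof.
move=> _ _ [B [mB ->]] [B' [mB' ->]]; exists (fun i => B i `&` B' i); split.
  by move=> i; exact: measurableI.
rewrite predeqE => w; split=> [[h h'] i iA|h].
  by split; [exact: h|exact: h'].
by split=> i iA; have [] := h i iA.
Qed.

Hypothesis indepZ : mutually_independent Z.

(** As functions of [E], both sides are finite measures that agree on the cylinders, hence on the
    sigma-algebra they generate. *)
Lemma independent_cylinders A (j : I) E (C : set R) :
  j \notin A -> <<s cylinders Z A >> E -> measurable C ->
  P (Z j @^-1` C `&` E) = (P (Z j @^-1` C) * P E)%E.
Proof.
move=> jA sE mC.
have mF : measurable (Z j @^-1` C).
  by rewrite -[X in measurable X]setTI; exact: measurable_funP.
have PFfin : P (Z j @^-1` C) \is a fin_num by exact: fin_num_measure.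
have PF0 : 0 <= fine (P (Z j @^-1` C)) by exact: fine_ge0.
pose m1 : {measure set T -> \bar R} := mrestr P mF.
pose m2 : {measure set T -> \bar R} := mscale (NngNum PF0) P.
suff : m1 E = m2 E by rewrite /m1 /m2 /= /mrestr /mscale /= fineK // setIC.
apply: (@g_sigma_algebra_measure_unique _ R T (cylinders Z A) _ (fun=> setT)) => //.
- exact: cylinders_measurable.
- by move=> _; exact: cylinders_setT.
- by rewrite bigcup_const.
- exact: cylinders_setI.
- move=> _ [B [mB ->]]; rewrite /m1 /m2 /= /mrestr /mscale /= fineK //.
  (* The event on [Z j] and the cylinder over [A] merge into a single cylinder over [j |: A]; as [j]
     is outside [A], the sets [B i] with [i] in [A] are unchanged. *)
  pose B' i := if i == j then C else B i.
  have mB' i : measurable (B' i) by rewrite /B'; case: ifP.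
  have B'A i : i \in A -> B' i = B i.
    by move=> iA; rewrite /B'; case: eqP => // ij; rewrite -ij iA in jA.
  have := @indepZ (j |: A)%SET B' (fun i _ => mB' i).
  rewrite big_setU1 //= {2}/B' eqxx => h.
  rewrite (_ : _ `&` _ = \bigcap_(i in [set` (j |: A)%SET]) Z i @^-1` B' i).
    rewrite h; congr (_ * _)%E.
    rewrite (@indepZ A B) //.
    by apply: eq_bigr => i iA; rewrite B'A.
  rewrite predeqE => w; split=> [[hB hC] i|hw].
    rewrite /= !inE => /orP[/eqP ->|iA]; first by rewrite /B' eqxx.
    by rewrite B'A //; exact: hB.
  split; last by have := hw j; rewrite /= /B' eqxx; apply; rewrite !inE eqxx.
  by move=> i iA; have := hw i; rewrite /= B'A //; apply; rewrite /= !inE iA orbT.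
- move=> _; rewrite /m1 /= /mrestr /= setTI.
  by rewrite ltey_eq PFfin.
Qed.

(** By [independent_cylinders], the restriction of [P] to [E] and the multiple of [P] by [P E] have
    the same image measure under [Z j]. *)
Lemma ge0_integral_independent A (j : I) E (f : R -> \bar R) :
  j \notin A -> <<s cylinders Z A >> E ->
  @measurable_fun _ _ R (\bar R) setT f ->
  (forall x, 0 <= f x)%E ->
  (\int[P]_(w in E) f (Z j w) = P E * \int[P]_w f (Z j w))%E.
Proof.
move=> jA sE mf f0.
have mE := g_cylinders_measurable sE.
have PE0 : 0 <= fine (P E) by exact: fine_ge0.
pose m1 : {measure set T -> \bar R} := mrestr P mE.
pose m2 : {measure set T -> \bar R} := mscale (NngNum PE0) P.
have mfZ D : measurable_fun D (f \o Z j).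
  by apply: (measurable_funS measurableT) => //; exact: measurableT_comp.
(* The complement of [E] is null for [m1], so the integral over [E] becomes one over the whole
   space. *)
have -> : (\int[P]_(w in E) f (Z j w) = \int[m1]_w f (Z j w))%E.
  rewrite -(setUv E) integral_setU //; last 2 first.
  - exact: measurableC.
  - by rewrite disj_set2E setICr.
  rewrite [X in (_ + X)%E](_ : _ = 0%E) ?adde0.
    apply: eq_measure_integral => B mB BE.
    by rewrite /m1 /= /mrestr setIidl.
  apply: null_set_integral => //; first exact: measurableC.
  by rewrite /m1 /= /mrestr setICl measure0.
transitivity (\int[m2]_w f (Z j w))%E; last first.
  by rewrite ge0_integral_mscale //= fineK //; exact: fin_num_measure.
have := @ge0_integral_pushforward _ _ T _ R (Z j) (measurable_funP (Z j)).
move=> h; rewrite -[LHS](h m1 setT f) // -[RHS](h m2 setT f) //.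
apply: eq_measure_integral => C mC _.
change (m1 (Z j @^-1` C) = m2 (Z j @^-1` C)).
rewrite /m1 /m2 /= /mrestr /mscale /= (independent_cylinders jA) //.
by rewrite muleC fineK //; exact: fin_num_measure.
Qed.

Lemma integral_independent_eq0 A (j : I) E :
  j \notin A -> <<s cylinders Z A >> E ->
  P.-integrable setT (EFin \o Z j) -> ('E_P[Z j] = 0)%E ->
  (\int[P]_(w in E) (Z j w)%:E = 0)%E.
Proof.
move=> jA sE intZ; rewrite unlock => EZ.
have posE : ((EFin \o Z j)^\+ = (@EFin R)^\+ \o Z j)%E.
  by apply/funext => w; rewrite /= !funeposE.
have negE : ((EFin \o Z j)^\- = (@EFin R)^\- \o Z j)%E.
  by apply/funext => w; rewrite /= !funenegE.
rewrite -[LHS]/(\int[P]_(w in E) (EFin \o Z j) w)%E integralE posE negE.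
rewrite !(ge0_integral_independent jA sE) //; last 2 first.
- exact: (measurable_funeneg (@EFin_measurable R _)).
- exact: (measurable_funepos (@EFin_measurable R _)).
(* Factoring [P E] out of the difference is legitimate because integrability makes the negative part
   finite; what remains is the expectation. *)
rewrite -muleBr; last 2 first.
- by apply: fin_num_measure; exact: g_cylinders_measurable sE.
- have := integrable_neg_fin_num measurableT intZ.
  by rewrite negE => fin_neg; apply: fin_num_adde_defl; rewrite fin_numN.
move: EZ; rewrite -[X in X = _]/(\int[P]_w (EFin \o Z j) w)%E integralE posE negE.
by move=> ->; rewrite mule0.
Qed.
End conditional.

(** * Comparison with conditional expectations, stable under sums and maxima *)

Section conditional_le.
Context {R : realType} {d : measure_display} {T : measurableType d}.
Context (P : probability T R) (G : set (set T)).
Hypothesis mG : <<s G >> `<=` measurable.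
Implicit Types X Y : T -> R.

(* [X <= E(X' | G)] almost surely, for [X] measurable with respect to [G]; this
   formulation avoids conditional expectations. *)
Definition conditional_le X X' := [/\
  measurable_fun setT (X : g_sigma_algebraType G -> R),
  P.-integrable setT (EFin \o X), P.-integrable setT (EFin \o X') &
  forall E, <<s G >> E ->
    (\int[P]_(w in E) (X w)%:E <= \int[P]_(w in E) (X' w)%:E)%E].

Lemma conditional_le_refl X :
  measurable_fun setT (X : g_sigma_algebraType G -> R) ->
  P.-integrable setT (EFin \o X) -> conditional_le X X.
Proof. by split. Qed.

Lemma conditional_le0 : conditional_le (fun=> 0) (fun=> 0).
Proof.
by apply: conditional_le_refl => //; exact: integrable0.
Qed.

Lemma conditional_leD X X' Y Y' : conditional_le X X' -> conditional_le Y Y' ->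
  conditional_le (fun w => X w + Y w) (fun w => X' w + Y' w).
Proof.
move=> [mX iX iX' XX'] [mY iY iY' YY']; split.
- exact: measurable_funD.
- exact: (integrableD measurableT iX iY).
- exact: (integrableD measurableT iX' iY').
move=> E sE; have mE := mG sE.
have iE V : P.-integrable setT (EFin \o V) -> P.-integrable E (EFin \o V).
  exact: integrableS.
under eq_integral do rewrite EFinD.
under [leRHS]eq_integral do rewrite EFinD.
rewrite (integralD mE (iE _ iX) (iE _ iY)) (integralD mE (iE _ iX') (iE _ iY')).
by apply: leeD; [exact: XX'|exact: YY'].
Qed.

Lemma integrable_maxr X Y :
  P.-integrable setT (EFin \o X) -> P.-integrable setT (EFin \o Y) ->
  P.-integrable setT (EFin \o (fun w => Num.max (X w) (Y w))).
Proof.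
move=> iX iY.
have mX := measurable_int _ iX; have mY := measurable_int _ iY.
apply: (le_integrable measurableT _ _ (integrableD measurableT
  (integrable_abse iX) (integrable_abse iY))).
  apply/measurable_EFinP/measurable_maxr; exact/measurable_EFinP.
move=> w _ /=; rewrite lee_fin [leRHS]ger0_norm ?addr_ge0 //.
by case: (leP (X w) (Y w)) => _; rewrite ?lerDl ?lerDr.
Qed.

(** The form of conditional Jensen used here: on events of the sigma-algebra where [X] is the
    larger, the integral of the maximum is that of [X], hence at most that of [X'] and of the
    maximum on the right; likewise for [Y]. *)
Lemma conditional_le_max X X' Y Y' : conditional_le X X' -> conditional_le Y Y' ->
  conditional_le (fun w => Num.max (X w) (Y w)) (fun w => Num.max (X' w) (Y' w)).
Proof.
move=> [mX iX iX' XX'] [mY iY iY' YY'].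
have iM := integrable_maxr iX iY; have iM' := integrable_maxr iX' iY'.
split => //; first exact: measurable_maxr.
move=> E sE; have mE := mG sE.
(* On [D] the maximum is [X], off [D] it is [Y], and [D] belongs to [<<s G >>]. *)
pose D := [set w | Y w <= X w].
have sD : <<s G >> D.
  have := @measurable_fun_le _ (g_sigma_algebraType G) R setT Y X measurableT mY mX.
  by rewrite setTI.
have sE1 : <<s G >> (E `&` D).
  exact: (@measurableI _ (g_sigma_algebraType G)).
have sE2 : <<s G >> (E `&` ~` D).
  apply: (@measurableI _ (g_sigma_algebraType G)) => //.
  exact: (@measurableC _ (g_sigma_algebraType G)).
have mE1 := mG sE1; have mE2 := mG sE2.
have iE F V : measurable F -> P.-integrable setT (EFin \o V) ->
    P.-integrable F (EFin \o V).
  by move=> mF; exact: integrableS.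
have EU : E = (E `&` D) `|` (E `&` ~` D) by rewrite -setIUr setUv setIT.
have dE : [disjoint E `&` D & E `&` ~` D].
  by rewrite disj_set2E setIACA setICr setI0.
have split V : P.-integrable setT (EFin \o V) ->
    (\int[P]_(w in E) (V w)%:E = \int[P]_(w in E `&` D) (V w)%:E
      + \int[P]_(w in E `&` ~` D) (V w)%:E)%E.
  move=> iV; rewrite [in LHS]EU integral_setU // -EU.
  exact: (measurable_int _ (iE _ _ mE iV)).
rewrite (split _ iM) (split _ iM'); apply: leeD.
- apply: (@le_trans _ _ (\int[P]_(w in E `&` D) (X w)%:E)%E).
    by rewrite le_eqVlt; apply/orP; left; apply/eqP; apply: eq_integral => w;
      rewrite inE => -[_ /max_idPl ->].
  apply: (le_trans (XX' _ sE1)); apply: le_integral => //; try exact: iE.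
  by move=> w _; rewrite lee_fin le_max lexx.
- apply: (@le_trans _ _ (\int[P]_(w in E `&` ~` D) (Y w)%:E)%E).
    rewrite le_eqVlt; apply/orP; left; apply/eqP; apply: eq_integral => w.
    by rewrite inE => -[_ /negP]; rewrite -ltNge => /ltW /max_idPr ->.
  apply: (le_trans (YY' _ sE2)); apply: le_integral => //; try exact: iE.
  by move=> w _; rewrite lee_fin le_max lexx orbT.
Qed.

(** Serves for finite sums and for iterated maxima alike, since both start from the default value 0,
    compared with itself by [conditional_le0]. *)
Lemma conditional_le_big (op : R -> R -> R) (I : finType) (Q : pred I)
    (X X' : I -> T -> R) :
  (forall Y Y' V V', conditional_le Y Y' -> conditional_le V V' ->
    conditional_le (fun w => op (Y w) (V w)) (fun w => op (Y' w) (V' w))) ->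
  (forall i, conditional_le (X i) (X' i)) ->
  conditional_le (fun w => \big[op/0]_(i | Q i) X i w)
                 (fun w => \big[op/0]_(i | Q i) X' i w).
Proof.
move=> le_op XX'; elim: (index_enum I) => [|i r IH].
  have big0 F : (fun w : T => \big[op/0]_(i <- [::] | Q i) F i w) = fun=> 0.
    by apply/funext => w; rewrite big_nil.
  by rewrite !big0; exact: conditional_le0.
have bigS F : (fun w : T => \big[op/0]_(i <- i :: r | Q i) F i w) =
    fun w => if Q i then op (F i w) (\big[op/0]_(i <- r | Q i) F i w)
             else \big[op/0]_(i <- r | Q i) F i w.
  by apply/funext => w; rewrite big_cons.
by rewrite !bigS; case: (Q i) => //; exact: le_op.
Qed.
End conditional_le.

(** * Conditioning linear forms on a subset of the variables *)

Section linear_combinations.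
Context {R : realType} {d : measure_display} {T : measurableType d}.
Context (P : probability T R) {N : nat} (Z : 'I_N -> {RV P >-> R}).
Hypothesis indepZ : mutually_independent Z.
Hypothesis intZ : forall i, P.-integrable setT (EFin \o Z i).
Hypothesis EZ0 : forall i, ('E_P[Z i] = 0)%E.

(** Conditioning on the variables in [A] keeps their terms, which are measurable, and kills the
    others, which are centered and independent of them. *)
Lemma conditional_le_linear (A : {set 'I_N}) (a b : 'I_N -> R) :
  (forall i, i \in A -> b i = a i) -> (forall i, i \notin A -> b i = 0) ->
  conditional_le P (cylinders Z A)
    (fun w => \sum_i b i * Z i w) (fun w => \sum_i a i * Z i w).
Proof.
move=> bA bC.
have mG := @g_cylinders_measurable _ _ _ _ _ Z A.
apply: (conditional_le_big xpredT) => [*|i].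
  exact: conditional_leD.
have iZ : P.-integrable setT (EFin \o (fun w => a i * Z i w)).
  exact: (integrableZl measurableT (a i) (intZ i)).
case: (boolP (i \in A)) => iA.
  rewrite bA //; apply: conditional_le_refl => //.
  apply: measurable_funM => //.
  move=> _ B mB; rewrite setTI; apply: sub_sigma_algebra.
  (* The preimage of [B] under [Z i] is the cylinder constrained only at coordinate [i]. *)
  exists (fun j => if j == i then B else setT); split.
    by move=> j; case: ifP.
  rewrite predeqE => w; split=> [Bw j _|]; last first.
    by move/(_ i iA); rewrite eqxx.
  by case: eqP => // ->.
rewrite bC // (_ : (fun w => 0 * Z i w) = fun=> 0); last first.
  by apply/funext => w; rewrite mul0r.
split=> //; first exact: integrable0.
move=> E sE; have mE := mG _ sE.
rewrite integral0 -[leRHS]/(\int[P]_(w in E) ((a i)%:E * (EFin \o Z i) w))%E.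
rewrite integralZl //; last exact: integrableS (intZ i).
by rewrite [X in (_ * X)%E](integral_independent_eq0 indepZ iA sE) // mule0.
Qed.
End linear_combinations.

(** * Seminorm properties and measurability of the maxima *)

Lemma max_normalized_sumN (R : realType) (T : Type) (N : nat)
    (Z : 'I_N -> T -> R) (S : {set {set 'I_N}}) (w : T) :
  max_normalized_sum (fun i w => - Z i w) S w = max_normalized_sum Z S w.
Proof.
by apply: eq_bigr => I _; rewrite /partial_sum sumrN normrN.
Qed.

Lemma max_normalized_sumD (R : realType) (T : Type) (N : nat)
    (X Y : 'I_N -> T -> R) (S : {set {set 'I_N}}) (w : T) :
  max_normalized_sum (fun i w => X i w + Y i w) S w <=
  max_normalized_sum X S w + max_normalized_sum Y S w.
Proof.
apply: bigmax_le => [|I IS]; first by rewrite addr_ge0 ?bigmax_ge_id.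
rewrite /partial_sum big_split /=.
apply: (@le_trans _ _ (`|partial_sum X I w| / Num.sqrt (#|I|%:R)
    + `|partial_sum Y I w| / Num.sqrt (#|I|%:R))).
  by rewrite -mulrDl ler_wpM2r ?invr_ge0 ?sqrtr_ge0 ?ler_normD.
by apply: lerD; apply: (le_bigmax_cond 0
  (fun I : {set 'I_N} => `|partial_sum _ I w| / Num.sqrt (#|I|%:R)) IS).
Qed.

Lemma max_normalized_sum_ge0 (R : realType) (T : Type) (N : nat)
    (Z : 'I_N -> T -> R) (S : {set {set 'I_N}}) (w : T) :
  0 <= max_normalized_sum Z S w.
Proof. exact: bigmax_ge_id. Qed.

Lemma measurable_max_abs (R : realType) (d : measure_display)
    (T : measurableType d) (N : nat) (Z : 'I_N -> T -> R) :
  (forall i, measurable_fun setT (Z i)) -> measurable_fun setT (max_abs Z).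
Proof.
move=> mZ; rewrite /max_abs; elim: (index_enum _) => [|i r IH].
  rewrite (_ : (fun w => _) = cst 0) //.
  by apply/funext => w; rewrite big_nil.
rewrite (_ : (fun w => _) = fun w =>
    Num.max `|Z i w| (\big[Num.max/0]_(j <- r) `|Z j w|)).
  by apply: measurable_maxr => //; exact: measurableT_comp.
by apply/funext => w; rewrite big_cons.
Qed.

(** * Symmetrization for a fixed vector of signs *)

Section signed_variables.
Context {R : realType} {d : measure_display} {T : measurableType d}.
Context (P : probability T R) {N : nat} (Z : 'I_N -> {RV P >-> R}).
Hypothesis indepZ : mutually_independent Z.
Hypothesis intZ : forall i, P.-integrable setT (EFin \o Z i).
Hypothesis EZ0 : forall i, ('E_P[Z i] = 0)%E.
Variable S : {set {set 'I_N}}.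

Let Phi (a : 'I_N -> R) : T -> R :=
  max_normalized_sum (fun i w => a i * Z i w) S.

(** Conditional Jensen for the seminorm: [Phi] is a finite maximum of linear forms, and the
    comparison passes from these to their maximum. *)
Lemma conditional_le_max_normalized_sum (A : {set 'I_N}) (a b : 'I_N -> R) :
  (forall i, i \in A -> b i = a i) -> (forall i, i \notin A -> b i = 0) ->
  conditional_le P (cylinders Z A) (Phi b) (Phi a).
Proof.
move=> bA bC; have mG := @g_cylinders_measurable _ _ _ _ _ Z A.
have PhiE c : Phi c = fun w => \big[Num.max/0]_(I in S)
    Num.max (\sum_i (i \in I)%:R / Num.sqrt (#|I|%:R) * c i * Z i w)
            (\sum_i - ((i \in I)%:R / Num.sqrt (#|I|%:R) * c i) * Z i w).
  by apply/funext => w; apply: eq_bigr => I _; rewrite normalized_absE.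
rewrite !PhiE; apply: conditional_le_big => // [*|I].
  exact: conditional_le_max.
apply: conditional_le_max => //; apply: conditional_le_linear => // i iA.
- by rewrite bA.
- by rewrite bC // mulr0.
- by rewrite bA.
- by rewrite bC // mulr0 oppr0.
Qed.

Lemma integrable_max_normalized_sum a : P.-integrable setT (EFin \o Phi a).
Proof.
(* Integrability is one component of [conditional_le], here used with every coordinate kept. *)
suff [] : conditional_le P (cylinders Z [set: 'I_N]) (Phi a) (Phi a) by [].
by apply: conditional_le_max_normalized_sum => // i; rewrite inE.
Qed.

Lemma symmetrization (e : {ffun 'I_N -> bool}) :
  (\int[P]_w (Phi (fun=> 1) w)%:E
    <= 2%:E * \int[P]_w (Phi (fun i => (-1) ^+ e i) w)%:E)%E.
Proof.
pose s i : R := (-1) ^+ e i.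
(* The coordinates carrying the sign +1. *)
pose A := [set i | ~~ e i]%SET.
pose b (B : {set 'I_N}) i : R := (i \in B)%:R.
have PhiN a : Phi (fun i => - a i) = Phi a.
  apply/funext => w; rewrite -[RHS]max_normalized_sumN.
  by apply: eq_bigr => I _; congr (`|_| / _); apply: eq_bigr => i _; rewrite mulNr.
have le_part (B : {set 'I_N}) a : (forall i, i \in B -> a i = 1) ->
    (\int[P]_w (Phi (b B) w)%:E <= \int[P]_w (Phi a w)%:E)%E.
  move=> aB; suff [_ _ _] : conditional_le P (cylinders Z B) (Phi (b B)) (Phi a).
    by apply; exact: (@measurableT _ (g_sigma_algebraType (cylinders Z B))).
  apply: conditional_le_max_normalized_sum => i iB.
    by rewrite aB // /b iB.
  by rewrite /b (negPf iB).
have leA : (\int[P]_w (Phi (b A) w)%:E <= \int[P]_w (Phi s w)%:E)%E.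
  by apply: le_part => i; rewrite inE /s => /negPf ->.
have leC : (\int[P]_w (Phi (b (~: A)) w)%:E <= \int[P]_w (Phi s w)%:E)%E.
  (* Off [A] the signs are -1, so the comparison is applied to the opposite vector, on which [Phi]
     takes the same value. *)
  rewrite -(PhiN s); apply: le_part => i; rewrite !inE negbK /s => ->.
  by rewrite expr1 opprK.
apply: (@le_trans _ _
  (\int[P]_w (Phi (b A) w)%:E + \int[P]_w (Phi (b (~: A)) w)%:E)%E).
  rewrite -integralD //; [|exact: integrable_max_normalized_sum..].
  apply: le_integral => //.
  - exact: integrable_max_normalized_sum.
  - by apply: integrableD => //; exact: integrable_max_normalized_sum.
  move=> w _; rewrite -EFinD lee_fin.
  have -> : Phi (fun=> 1) w = max_normalized_sum
      (fun i w => b A i * Z i w + b (~: A)%SET i * Z i w) S w.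
    apply: eq_bigr => I _; congr (`|_| / _).
    apply: eq_bigr => i _; rewrite /b finset.in_setC -mulrDl.
    by case: (i \in A); rewrite ?addr0 ?add0r.
  exact: max_normalized_sumD.
rewrite -[2%:E]/(1 + 1)%:E EFinD muleDl ?mul1e //; first exact: leeD.
exact: integrable_fin_num (integrable_max_normalized_sum _).
Qed.
End signed_variables.

(** * Averaging over the signs *)

Theorem lemma4p2 (R : realType) :
  exists C : R, 0 < C /\
    forall (N : nat) (d : measure_display) (T : measurableType d)
      (P : probability T R) (Z : 'I_N -> {RV P >-> R}),
      mutually_independent Z ->
      (forall i : 'I_N, P.-integrable setT (EFin \o Z i)) ->
      (forall i : 'I_N, ('E_P[Z i] = 0)%E) ->
      forall S : {set {set 'I_N}},
        (forall I : {set 'I_N}, I \in S -> I != finset.set0) ->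
        (2 <= #|S|)%N ->
        ('E_P[max_normalized_sum (fun i => Z i : T -> R) S]
          <= (C * Num.sqrt (ln (#|S|%:R)))%:E
             * 'E_P[max_abs (fun i => Z i : T -> R)])%E.
Proof.
(* The constant is the 2 of the symmetrization times the 4 of the pointwise sign average. *)
exists 8; split=> // N d T P Z indepZ intZ EZ0 S S0 S2.
rewrite unlock.
pose Phi (a : 'I_N -> R) : T -> R :=
  max_normalized_sum (fun i w => a i * Z i w) S.
have -> : max_normalized_sum (fun i => Z i : T -> R) S = Phi (fun=> 1).
  apply/funext => w; apply: eq_bigr => I _; congr (`|_| / _).
  by apply: eq_bigr => i _; rewrite mul1r.
set M := max_abs _.
have mM : measurable_fun setT M by exact: measurable_max_abs.
have M0 w : 0 <= M w by exact: max_abs_ge0.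
pose L : R := Num.sqrt (ln #|S|%:R).
have L0 : 0 <= L by rewrite sqrtr_ge0.
have iPhi a := integrable_max_normalized_sum indepZ intZ EZ0 S a.
have p2 : 0 < 2 ^+ N :> R by rewrite exprn_gt0.
(* Multiplying by the number of sign vectors replaces the average by a sum, so that [symmetrization]
   applies term by term. *)
rewrite -(@lee_pmul2l _ (2 ^+ N)%:E) ?lte_fin //.
have -> : ((2 ^+ N)%:E * \int[P]_w (Phi (fun=> 1) w)%:E =
    \sum_(e : {ffun 'I_N -> bool}) \int[P]_w (Phi (fun=> 1) w)%:E)%E.
  rewrite -(@fineK _ (\int[P]_w (Phi _ w)%:E)%E); last first.
    exact: integrable_fin_num (iPhi _).
  rewrite sumEFin -EFinM sumr_const card_ffun card_bool card_ord.
  by rewrite -natrX mulr_natl.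
apply: (@le_trans _ _ (\sum_(e : {ffun 'I_N -> bool})
    2%:E * \int[P]_w (Phi (fun i => (-1) ^+ e i) w)%:E)%E).
  by apply: lee_sum => e _; exact: symmetrization.
rewrite -ge0_sume_distrr; last first.
  by move=> e _; apply: integral_ge0 => w _; rewrite lee_fin max_normalized_sum_ge0.
rewrite -integral_sum //; last by move=> e; exact: iPhi.
(* With the sum inside the integral, the integrand at a fixed [w] is [2 ^+ N] times a sign average,
   hence at most [2 ^+ N * (4 * L) * M w]. *)
apply: (@le_trans _ _ (2%:E * \int[P]_w ((2 ^+ N * (4 * L))%:E * (M w)%:E))%E).
  rewrite lee_pmul2l ?lte_fin //; apply: ge0_le_integral => //.
  - move=> w _; apply: sume_ge0 => e _; rewrite lee_fin.
    exact: max_normalized_sum_ge0.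
  - by apply: emeasurable_sum => e; exact: measurable_int (iPhi _).
  - by apply: measurable_funeM; exact/measurable_EFinP.
  move=> w _; rewrite sumEFin -EFinM lee_fin.
  have := sign_average_max_normalized_sum Z w S0 S2.
  rewrite /sign_average ler_pdivrMr // => /le_trans; apply.
  by rewrite [leLHS]mulrC !mulrA.
rewrite (@ge0_integralZl_EFin _ _ _ P setT measurableT (EFin \o M)) //; last 3 first.
- by move=> w _; rewrite lee_fin.
- exact/measurable_EFinP.
- by rewrite !mulr_ge0 // ltW.
rewrite !muleA -!EFinM le_eqVlt; apply/orP; left; apply/eqP.
by congr (_%:E * _)%E; rewrite /L; ring.
Qed.
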